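(* Let $\Delta:(0,\infty)\to\mathbb R$ be a function satisfying condition $(\Delta)$ stated in the context, put $$\psi_\Delta(p)=p\,e^{-\Delta(p)/p}\ (p\ge1),\qquad \phi_\Delta(\lambda)=\Delta^*(\ln|\lambda|)\ (\lambda\in\mathbb R\setminus\{0\}),\quad \phi_\Delta(0)=0,$$ and assume $\phi_\Delta\in\Phi$ (with $\lambda_0=\infty$). Then there is a finite constant $C$, depending only on $\Delta$, such that for every centered random variable $\xi\in G\psi_\Delta$, $$\|\xi\|B(\phi_\Delta)\le C\,\|\xi\|G\psi_\Delta.$$
   Context: Centered means $\mathbf E\xi=0$. $|\xi|_p=(\mathbf E|\xi|^p)^{1/p}$, and for a positive function $\psi$ on $[1,\infty)$, $G\psi$ is the set of random variables with finite norm $\|\xi\|G\psi=\sup_{p\ge1}|\xi|_p/\psi(p)$. $\Phi$ (with $\lambda_0=\infty$) is the set of even, strictly convex, twice continuously differentiable functions $\phi:\mathbb R\to\mathbb R$, positive for positive arguments, with $\phi(0)=\phi'(0)=0$, $\phi''(0)>0$, $\lim_{\lambda\to\infty}\phi(\lambda)/\lambda=\infty$. For $\phi\in\Phi$ and centered $\xi$, $\|\xi\|B(\phi)=\inf\{\tau>0:\ \max_{\pm}\mathbf E\exp(\pm\lambda\xi)\le\exp(\phi(\lambda\tau))\ \forall\lambda\in\mathbb R\}$. For $\Delta:(0,\infty)\to\mathbb R$ put $\Delta^*(\mu)=\sup_{p>0}(p\mu-\Delta(p))$, $\sigma(\epsilon)=\sum_{k=2,4,6,\ldots}e^{\Delta(\epsilon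 k)-\Delta(k)}$ for $\epsilon\in(0,1)$, and $\Delta_1^*(\mu)=\inf_{\epsilon\in(0,1)}\ln\bigl\{\sigma(\epsilon)\exp(\Delta^*(\mu/\epsilon))\bigr\}$. Condition $(\Delta)$: there is a constant $C_4\in[1,\infty)$ such that $\Delta_1^*(\ln|\lambda|)\le\Delta^*(\ln|C_4\lambda|)$ for all $\lambda\in\mathbb R\setminus\{0\}$. *)

(* Defs.v *)
From HB Require Import structures.
From mathcomp Require Import all_boot all_order all_algebra.
From mathcomp Require Import all_classical all_reals all_analysis.

Set Implicit Arguments.
Unset Strict Implicit.
Unset Printing Implicit Defensive.

Import Order.TTheory GRing.Theory Num.Theory.
Import numFieldNormedType.Exports.

Local Open Scope classical_set_scope.
Local Open Scope ring_scope.
Local Open Scope ereal_scope.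

(* A function on (0, +oo) is a total function [R -> R] of which only the values
   at positive arguments are ever used. *)

Definition young_conj (R : realType) (Delta : R -> R) (mu : R) : \bar R :=
  ereal_sup [set (p * mu - Delta p)%:E | p in [set p : R | (0 < p)%R]].

(* The summation index k = 2, 4, 6, ... is k = 2 j with j >= 1. *)
Definition sigma_Delta (R : realType) (Delta : R -> R) (eps : R) : \bar R :=
  \sum_(1 <= j <oo)
    (expR (Delta (eps * (j.*2)%:R) - Delta (j.*2)%:R))%:E.

(* The product below is never of the form 0 * +oo: [sigma_Delta] is positive
   and [young_conj] is never -oo. *)
Definition Delta1_conj (R : realType) (Delta : R -> R) (mu : R) : \bar R :=
  ereal_inf [set lne (sigma_Delta Delta eps *
                      expeR (young_conj Delta (mu / eps)))
            | eps in [set eps : R | (0 < eps < 1)%R]].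

Definition condition_Delta (R : realType) (Delta : R -> R) : Prop :=
  exists2 C4 : R, (1 <= C4)%R &
    forall l : R, l != 0%R ->
      Delta1_conj Delta (ln `|l|%R) <= young_conj Delta (ln `|C4 * l|%R).

Definition psi_Delta (R : realType) (Delta : R -> R) (p : R) : R :=
  (p * expR (- (Delta p / p)))%R.

Definition phi_Delta (R : realType) (Delta : R -> R) (l : R) : \bar R :=
  if l == 0%R then 0 else young_conj Delta (ln `|l|%R).

Definition strictly_convex (R : realType) (phi : R -> R) : Prop :=
  forall x y t : R, x != y -> (0 < t < 1)%R ->
    (phi (t * x + (1 - t) * y) < t * phi x + (1 - t) * phi y)%R.

Definition twice_continuously_differentiable (R : realType) (phi : R -> R) :
    Prop :=
  [/\ forall x, derivable phi x 1,
      forall x, derivable (derive1 phi) x 1 &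
      continuous (derive1n 2 phi)].

Record class_Phi (R : realType) (phi : R -> R) : Prop := ClassPhi {
  Phi_even : forall x, phi (- x)%R = phi x;
  Phi_strictly_convex : strictly_convex phi;
  Phi_C2 : twice_continuously_differentiable phi;
  Phi_pos : forall x, (0 < x)%R -> (0 < phi x)%R;
  Phi_0 : phi 0%R = 0%R;
  Phi_derive_0 : (derive1 phi) 0%R = 0%R;
  Phi_derive2_0 : (0 < (derive1n 2 phi) 0)%R;
  Phi_superlinear : (phi x / x)%R @[x --> +oo%R] --> +oo%R
}.

Definition normG d (T : measurableType d) (R : realType) (P : probability T R)
    (psi : R -> R) (X : T -> R) : \bar R :=
  ereal_sup [set Lnorm P p%:E (EFin \o X) * (psi p)^-1%:E
            | p in [set p : R | (1 <= p)%R]].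

Definition in_G d (T : measurableType d) (R : realType) (P : probability T R)
    (psi : R -> R) (X : T -> R) : Prop :=
  normG P psi X < +oo.

(* ['M_P X l] is E exp(l X); the value is +oo when no tau is admissible. *)
Definition normB d (T : measurableType d) (R : realType) (P : probability T R)
    (phi : R -> R) (X : T -> R) : \bar R :=
  ereal_inf [set tau%:E | tau in [set tau : R | (0 < tau)%R /\
    forall l : R,
      maxe ('M_P X l) ('M_P X (- l)%R) <= (expR (phi (l * tau)))%:E]].

(* For an extended-real expectation, ['E_P[X] = 0] already forces X to be
   integrable. *)
Definition centered d (T : measurableType d) (R : realType)
    (P : probability T R) (X : T -> R) : Prop :=
  'E_P[X] = 0.

(* Main.v *)
(** Since [exp(-x) - 1 + x >= 0], one has [exp x - 1 - x <= 2 (cosh x - 1)], so for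
    centered [X] only the even moments enter the bound on [E exp(l X)].  These are at
    most [(N k)^k exp(-Delta k)] for [N >= ||X||G], and [k^k / k! <= e^k], whence
    [E exp(l X) <= 1 + S(2 e N |l|)] with [S r = \sum_(k = 2, 4, ...) r^k exp(-Delta k)].
    Splitting [r^k exp(-Delta k)] as [exp(Delta(eps k) - Delta k)] times
    [exp((eps k) (ln r / eps) - Delta(eps k))] and using condition (Delta) gives
    [S r <= exp(Delta1*(ln r)) <= exp(phi(C4 r))].  The summand 1 is absorbed by
    enlarging the argument of [phi]: for [r >= 1] by [t phi(x) <= phi(t x)], and for
    [r <= 1], where [S r <= r^2 S 1], by [phi(x) >= c x^2] near 0. *)

Require Import Defs.
From HB Require Import structures.
From mathcomp Require Import all_boot all_order all_algebra.
From mathcomp Require Import all_classical all_reals all_analysis.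
From mathcomp Require Import measurable_realfun ring lra.
Import Order.TTheory GRing.Theory Num.Theory.
Import numFieldNormedType.Exports.

Local Open Scope classical_set_scope.
Local Open Scope ring_scope.
Local Open Scope ereal_scope.

(** * Growth of functions of class Phi on the half-line *)

Section Phi.
Local Open Scope ring_scope.
Context {R : realType} {phi : R -> R} (hPhi : class_Phi phi).

(** Convexity between [0] and [t * x]: the point [x] has weight [t^-1], and [phi 0 = 0]. *)
Lemma Phi_scale (t x : R) : 1 <= t -> 0 <= x -> t * phi x <= phi (t * x).
Proof.
rewrite le_eqVlt => /predU1P[<- _|t1]; first by rewrite !mul1r.
rewrite le_eqVlt => /predU1P[<-|x0]; first by rewrite mulr0 (Phi_0 hPhi) mulr0.
have t0 : 0 < t by rewrite (lt_trans _ t1).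
have tx0 : t * x != 0 by rewrite mulf_neq0 ?gt_eqF.
have V : 0 < t^-1 < 1 by rewrite invr_gt0 t0 invf_lt1.
have := Phi_strictly_convex hPhi tx0 V.
rewrite mulr0 addr0 (Phi_0 hPhi) mulr0 addr0 mulKf ?gt_eqF//.
by rewrite ltr_pdivlMl// => /ltW.
Qed.

Lemma Phi_ge0 (x : R) : 0 <= x -> 0 <= phi x.
Proof.
rewrite le_eqVlt => /predU1P[<-|x0]; first by rewrite (Phi_0 hPhi).
exact/ltW/(Phi_pos hPhi).
Qed.

Lemma Phi_nondecreasing (x y : R) : 0 <= x -> x <= y -> phi x <= phi y.
Proof.
rewrite le_eqVlt => /predU1P[<-|x0] xy.
  by rewrite (Phi_0 hPhi) Phi_ge0.
have yx1 : 1 <= y / x by rewrite ler_pdivlMr// mul1r.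
have := Phi_scale _ _ yx1 (ltW x0); rewrite divfK ?gt_eqF//; apply: le_trans.
by rewrite ler_peMl// Phi_ge0// ltW.
Qed.

(** With [a = phi''(0) > 0], the quotient [phi'(h) / h] tends to [a], so [phi'(h) >= a / 2 * h] for
    small positive [h]. Hence [phi y - a / 4 * y ^+ 2] vanishes at 0 and is nondecreasing to the
    right of it. *)
Lemma Phi_quadratic_lower_bound : exists c x1 : R,
  [/\ 0 < c, 0 < x1 & forall x, 0 <= x <= x1 -> c * x ^+ 2 <= phi x].
Proof.
have [d1 d2 _] := Phi_C2 hPhi.
set a : R := derive1n 2 phi 0.
have a0 : 0 < a := Phi_derive2_0 hPhi.
have ca : h^-1 * (derive1 phi) h @[h --> 0^'] --> a.
  pose F (h : R) : R := h^-1 *: ((derive1 phi) (h + 0) - (derive1 phi) 0).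
  have -> : (fun h => h^-1 * (derive1 phi) h) = F.
    by apply/funext => h; rewrite /F (Phi_derive_0 hPhi) subr0 addr0.
  have -> : a = lim (F h @[h --> 0^']) by [].
  have := d2 0; rewrite /derivable.
  have -> // : (fun h : R => h^-1 *: (((derive1 phi) \o shift 0) (h *: 1)
    - (derive1 phi) 0)) = F.
  by apply/funext => h; rewrite /F /= /GRing.scale /= mulr1.
have /nbhs_ballP[e /= e0 he] : \forall h \near 0^', a / 2 < h^-1 * (derive1 phi) h.
  by apply: (cvgr_gt _ ca); lra.
have he' (x : R) : 0 < x < e -> a / 2 * x <= (derive1 phi) x.
  move=> /andP[x0 xe].
  have bx : ball (0 : R) e x by rewrite -ball_normE /ball_/= sub0r normrN gtr0_norm.
  by have := he x bx (lt0r_neq0 x0); rewrite ltr_pdivlMl// mulrC => /ltW.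
exists (a / 4), (e / 2); split; [lra|lra|move=> x /andP[x0 xe]].
pose g (y : R) := phi y - a / 4 * y ^+ 2.
have dg (y : R) : is_derive y 1 g ((derive1 phi) y - a / 2 * y).
  have dp : is_derive y 1 phi ((derive1 phi) y).
    by apply: DeriveDef; [exact: d1|rewrite derive1E].
  rewrite /g; apply: is_derive_eq; rewrite /GRing.scale/=; lra.
have cg : {within `[0, x], continuous g}.
  apply: continuous_subspaceT => y.
  by apply: differentiable_continuous; apply/derivable1_diffP; case: (dg y).
have g'0 (y : R) : y \in `]0, x[%R -> 0 <= derive1 g y.
  rewrite in_itv/= => /andP[y0 yx]; rewrite derive1E derive_val.
  by rewrite subr_ge0 he'// y0/=; lra.
have dg' (y : R) : y \in `]0, x[%R -> derivable g y 1 by case: (dg y).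
have m0 : 0 \in `[0, x] by rewrite in_itv/= lexx.
have mx : x \in `[0, x] by rewrite in_itv/= lexx x0.
have gx := @ger0_derive1_le_cc R g 0 x dg' g'0 cg 0 x m0 mx x0.
by move: gx; rewrite /g (Phi_0 hPhi) expr0n/= mulr0 subr0 subr_ge0.
Qed.

Lemma Phi_absorb (A K : R) : 0 <= A -> 1 <= K ->
  exists B : R, [/\ 0 < B,
    forall r, 0 <= r <= 1 -> 1 + A * r ^+ 2 <= expR (phi (B * r)) &
    forall r, 1 <= r -> 1 + expR (phi (K * r)) <= expR (phi (B * r))].
Proof.
move=> A0 K1.
have [c [x1 [c0 x10 hc]]] := Phi_quadratic_lower_bound.
have p1 : 0 < phi 1 by apply: (Phi_pos hPhi).
set M : R := (phi 1)^-1; have M0 : 0 < M by rewrite invr_gt0.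
set b1 : R := A / c; set b2 : R := A / (c * x1).
have b10 : 0 <= b1 by rewrite divr_ge0// ltW.
have b20 : 0 <= b2 by rewrite divr_ge0// mulr_ge0// ltW.
(* Each summand serves one case. The 1 gives [B <= B ^+ 2]; [b1] and [b2] handle [r <= 1] with
   [B * r] below and above [x1]; the last one handles [r >= 1]. *)
pose B := 1 + b1 + b2 + (1 + M) * K.
have KM : 0 <= (1 + M) * K by rewrite mulr_ge0; lra.
exists B; split; first by rewrite /B; lra.
- move=> r /andP[r0 r1]; apply: (le_trans (expR_ge1Dx _)); rewrite ler_expR.
  have B0 : 0 <= B by rewrite /B; lra.
  have Br0 : 0 <= B * r by rewrite mulr_ge0.
  have [Bx|Bx] := leP (B * r) x1.
    apply: (@le_trans _ _ (c * (B * r) ^+ 2)); last by rewrite hc// Br0.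
    rewrite exprMn (mulrA c) ler_wpM2r ?sqr_ge0// mulrC -ler_pdivrMr// -/b1.
    by apply: (@le_trans _ _ B); [rewrite /B; lra|rewrite ler_eXnr//; rewrite /B; lra].
  (* Outside the quadratic zone [phi] grows at least linearly from its value at [x1], and
     [A * r ^+ 2 <= A * r] since [r <= 1]. *)
  have Bx1 : 1 <= B * r / x1 by rewrite ler_pdivlMr// mul1r ltW.
  have := Phi_scale _ _ Bx1 (ltW x10); rewrite divfK ?gt_eqF//; apply: le_trans.
  have h1 : c * x1 ^+ 2 <= phi x1 by apply: hc; rewrite lexx ltW.
  apply: (@le_trans _ _ (B * r / x1 * (c * x1 ^+ 2))); last first.
    by rewrite ler_wpM2l// divr_ge0// ltW.
  have -> : B * r / x1 * (c * x1 ^+ 2) = (B * (c * x1)) * r.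
    by field; rewrite gt_eqF.
  apply: (@le_trans _ _ (A * r)).
    by rewrite ler_wpM2l// expr2 ler_piMr.
  rewrite ler_wpM2r// -ler_pdivrMr ?mulr_gt0// -/b2 /B; lra.
- move=> r r1; set x := K * r.
  have x1' : 1 <= x by rewrite /x mulr_ege1.
  have f1 : phi 1 <= phi x by apply: Phi_nondecreasing.
  (* As [M * phi x >= M * phi 1 = 1], multiplying the argument by [1 + M] adds at least 1 to the
     value. This 1 in the exponent is a factor e >= 2, which absorbs the summand 1. *)
  have fx : phi x + 1 <= phi (B * r).
    apply: (@le_trans _ _ (phi ((1 + M) * x))).
      apply: le_trans (Phi_scale _ _ _ _); [|lra|lra].
      by rewrite mulrDl mul1r lerD2l /M ler_pdivlMl// mulr1.
    apply: Phi_nondecreasing; first by rewrite mulr_ge0; lra.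
    by rewrite /x mulrA ler_wpM2r /B; lra.
  apply: (@le_trans _ _ (expR (phi x + 1))); last by rewrite ler_expR.
  rewrite expRD.
  have e1 : 1 <= expR (phi x) by rewrite -expR0 ler_expR; lra.
  have e2 : 1 + 1 <= expR (1 : R) := expR_ge1Dx 1.
  by nra.
Qed.
End Phi.

(** * The even power series and its bound by the conjugate of Delta *)

(* The exponents k = 2, 4, 6, ... are written k = (n.+1).*2 with n >= 0. *)
Definition even_series {R : realType} (Delta : R -> R) (r : R) : \bar R :=
  \sum_(n <oo) (r ^+ (n.+1).*2 * expR (- Delta ((n.+1).*2)%:R))%:E.

Section even_series.
Context {R : realType} (Delta : R -> R).

Lemma even_series_ge0 (r : R) : 0 <= even_series Delta r.
Proof.
apply: nneseries_ge0 => n _ _.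
by rewrite lee_fin mulr_ge0 ?expR_ge0// -mul2n exprM exprn_ge0 ?sqr_ge0.
Qed.

Lemma even_series_le1 (r : R) : (0 <= r <= 1)%R ->
  even_series Delta r <= (r ^+ 2)%:E * even_series Delta 1.
Proof.
move=> /andP[r0 r1]; rewrite /even_series -nneseriesZl; last first.
  by move=> n _; rewrite lee_fin expr1n mul1r expR_ge0.
apply: lee_nneseries => n _.
  by move=> _; rewrite lee_fin mulr_ge0 ?expR_ge0 ?exprn_ge0.
rewrite -EFinM lee_fin expr1n mul1r ler_wpM2r ?expR_ge0//.
by rewrite ler_wiXn2l// doubleS.
Qed.

Lemma sigma_DeltaE (eps : R) : sigma_Delta Delta eps =
  \sum_(n <oo) (expR (Delta (eps * ((n.+1).*2)%:R)
                      - Delta ((n.+1).*2)%:R))%:E.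
Proof.
rewrite /sigma_Delta -nneseries_addn; last by move=> n; rewrite lee_fin expR_ge0.
by apply: eq_eseriesr => n _; rewrite addn1.
Qed.

Lemma sigma_Delta_gt0 (eps : R) : 0 < sigma_Delta Delta eps.
Proof.
rewrite sigma_DeltaE; apply: lt_le_trans (nneseries_lim_ge 1 _).
  by rewrite big_nat1 lte_fin expR_gt0.
by move=> n _ _; rewrite lee_fin expR_ge0.
Qed.

Lemma young_conj_ge (mu p : R) : (0 < p)%R ->
  (p * mu - Delta p)%:E <= young_conj Delta mu.
Proof. by move=> p0; apply: ereal_sup_ubound; exists p. Qed.

Lemma even_series_le_sigma (r eps : R) : (0 < r)%R -> (0 < eps)%R ->
  even_series Delta r <=
  sigma_Delta Delta eps * expeR (young_conj Delta (ln r / eps)).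
Proof.
move=> r0 e0; have := fun p => young_conj_ge (ln r / eps) p.
(* A finite conjugate is compared term by term at the point [p = eps * k]. If it is +oo, so is the
   right side, because [sigma_Delta] is positive; the value -oo is excluded by the point [p = 1]. *)
case: (young_conj Delta _) => [y| |] hy.
- rewrite sigma_DeltaE muleC -nneseriesZl; last first.
    by move=> n _; rewrite lee_fin expR_ge0.
  apply: lee_nneseries => [n _ _|n _].
    by rewrite lee_fin mulr_ge0 ?expR_ge0 ?exprn_ge0// ltW.
  rewrite -EFinM lee_fin -{1}(lnK r0) -expRM_natl -!expRD ler_expR.
  have k0 : (0 < eps * ((n.+1).*2)%:R :> R)%R.
    by rewrite mulr_gt0// ltr0n doubleS.
  have := hy _ k0; rewrite lee_fin.
  have -> : (eps * ((n.+1).*2)%:R * (ln r / eps) = ((n.+1).*2)%:R * ln r)%R.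
    by field; rewrite gt_eqF.
  by lra.
- by rewrite /= gt0_muley ?leey// sigma_Delta_gt0.
- by have := hy 1%R ltr01.
Qed.

(** The left side does not depend on [eps], so after taking logarithms the preceding bound passes to
    the infimum over [eps]. *)
Lemma even_series_le_Delta1 (r : R) : (0 < r)%R ->
  even_series Delta r <= expeR (Delta1_conj Delta (ln r)).
Proof.
move=> r0; have /eqP <- : expeR (lne (even_series Delta r)) == even_series Delta r.
  by rewrite lneK_eq even_series_ge0.
rewrite lee_expeR; apply: le_ereal_inf_tmp => _ [eps /= /andP[e0 e1] <-].
rewrite lee_lne ?in_itv/= ?leey ?andbT ?even_series_ge0//.
  exact: even_series_le_sigma.
by rewrite mule_ge0 ?expeR_ge0// ltW// sigma_Delta_gt0.
Qed.

End even_series.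

(** * Estimates from the exponential series *)

Lemma cvg_double : n.*2 @[n --> \oo] --> \oo.
Proof.
by under eq_fun do rewrite -mul2n; exact: cvg_mulnl.
Qed.

Section expR.
Context {R : realType}.
Local Open Scope ring_scope.

(** Odd powers cancel. The partial sums stop at the exponent [2 m + 1]; the summand 2 comes from
    exponent 0, and the even exponents left are 2, ..., [2 m]. *)
Lemma series_exp_coeff_even (x : R) (m : nat) :
  series (exp_coeff x) (m.+1).*2 + series (exp_coeff (- x)) (m.+1).*2 =
  2 + \sum_(0 <= n < m) (2 * (x ^+ (n.+1).*2 / ((n.+1).*2)`!%:R)).
Proof.
have S2 (y : R) k : series (exp_coeff y) k.+2 =
    series (exp_coeff y) k + y ^+ k / k`!%:R + y ^+ k.+1 / (k.+1)`!%:R.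
  by rewrite /series/= !big_nat_recr.
elim: m => [|m IH].
  rewrite big_geq// addr0 (_ : 1.*2 = 2%N)// !S2 /series/= !big_geq//.
  by rewrite !expr0 !expr1 fact0 (_ : 1`! = 1%N)//; field.
rewrite big_nat_recr//= addrA -IH [(m.+2).*2]doubleS !S2.
have -> : (- x) ^+ (m.+1).*2 = x ^+ (m.+1).*2.
  by rewrite -mul2n !exprM sqrrN.
have -> : (- x) ^+ ((m.+1).*2).+1 = - x ^+ ((m.+1).*2).+1.
  by rewrite (exprS (- x)) (exprS x) -mul2n !exprM sqrrN mulNr.
by ring.
Qed.

(** The series sums to [expR x + expR (- x) - 2], which exceeds the left side by
    [expR (- x) - 1 + x >= 0]. *)
Lemma expR_sub1x_le (x : R) :
  ((expR x - 1 - x)%:E <=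
   \sum_(n <oo) (2 * (x ^+ (n.+1).*2 / ((n.+1).*2)`!%:R))%:E)%E.
Proof.
pose u m : R := \sum_(0 <= n < m) (2 * (x ^+ (n.+1).*2 / ((n.+1).*2)`!%:R)).
have cs (y : R) : series (exp_coeff y) (m.+1).*2 @[m --> \oo] --> expR y.
  apply: (@cvg_comp _ _ _ (fun m => (m.+1).*2) (series (exp_coeff y))
    \oo \oo (nbhs (expR y))); last exact: is_cvg_series_exp_coeff.
  have /= := cvg_shiftS double (nbhs \oo) => ->.
  exact: cvg_double.
have cu : u m @[m --> \oo] --> expR x + expR (- x) - 2.
  rewrite (_ : u = fun m => series (exp_coeff x) (m.+1).*2 +
      series (exp_coeff (- x)) (m.+1).*2 - 2).
    apply: cvgB; last exact: cvg_cst.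
    by apply: cvgD.
  by apply/funext => m; rewrite series_exp_coeff_even -/(u m); ring.
rewrite (_ : (\sum_(n <oo) _)%E = (expR x + expR (- x) - 2)%:E).
  by rewrite lee_fin; have := expR_ge1Dx (- x); lra.
rewrite -(cvg_lim _ cu)// -EFin_lim; last by apply/cvg_ex; eexists; exact: cu.
by apply/congr_lim/funext => m /=; rewrite sumEFin.
Qed.

(** The quotient of [n ^ n] by [n!] is the term of index [n] in the series of [expR n], whose terms
    are nonnegative. *)
Lemma exprn_le_fact_expR (n : nat) : n%:R ^+ n <= n`!%:R * expR n%:R :> R.
Proof.
rewrite mulrC -ler_pdivrMr ?ltr0n ?fact_gt0//.
have h := @nondecreasing_cvgn_le R (series (exp_coeff n%:R)) _ 
  (is_cvg_series_exp_coeff n%:R) n.+1.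
apply: le_trans (h _).
  rewrite /series/= big_nat_recr//= lerDr sumr_ge0// => i _.
  by rewrite exp_coeff_ge0.
apply/nondecreasing_seqP => m.
by rewrite /series/= big_nat_recr//= lerDl exp_coeff_ge0.
Qed.
End expR.

(** * From moments to the moment generating function *)

Section moments.
Context d (T : measurableType d) (R : realType) (P : probability T R).
Variables (Delta : R -> R) (X : {RV P >-> R}) (N : R).
Hypotheses (N0 : (0 < N)%R) (XN : normG P (psi_Delta Delta) X <= N%:E).

(** The k-th power of [psi_Delta Delta k] is [k ^ k * expR (- Delta k)]: the division by [p] in the
    exponent of [psi_Delta] cancels. *)
Lemma moment_le (k : nat) : (0 < k)%N ->
  \int[P]_x (`|X x| ^+ k)%:E <= ((N * k%:R) ^+ k * expR (- Delta k%:R))%:E.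
Proof.
move=> k0.
have k0R : (0 < k%:R :> R)%R by rewrite ltr0n.
have psi0 : (0 < psi_Delta Delta k%:R)%R by rewrite mulr_gt0 ?expR_gt0.
have LN : 'N[P]_(k%:R)%:E[EFin \o X] <= (N * psi_Delta Delta k%:R)%:E.
  rewrite EFinM -lee_pdivrMr//; apply: le_trans XN.
  by apply: ereal_sup_ubound; exists k%:R => //=; rewrite ler1n.
have kn0 : k%:R != 0%R :> R by rewrite gt_eqF.
have := gt0_ler_poweR (ltW k0R) _ _ LN.
rewrite !in_itv/= !leey !andbT lee_fin Lnorm_ge0 mulr_ge0 ?(ltW N0) ?(ltW psi0)//.
move=> /(_ isT isT); rewrite poweR_Lnorm// powR_mulrn; last first.
  by rewrite mulr_ge0// ltW.
have -> : ((N * psi_Delta Delta k%:R) ^+ k =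
           (N * k%:R) ^+ k * expR (- Delta k%:R))%R.
  by rewrite /psi_Delta mulrA exprMn -expRM_natl mulrN (mulrC k%:R (_ / _)%R) divfK.
rewrite (eq_integral (fun x => (`|X x| ^+ k)%:E))// => x _.
by rewrite /= powR_mulrn.
Qed.

Lemma normG_integrable : P.-integrable setT (EFin \o X).
Proof.
apply/integrableP; split; first exact/measurable_EFinP.
apply: le_lt_trans (ltry ((N * 1%:R) ^+ 1 * expR (- Delta 1%:R))).
by apply: le_trans (moment_le 1 _).
Qed.

Lemma expectation_sub1x_le (l : R) :
  \int[P]_x (expR (l * X x) - 1 - l * X x)%:E <=
  even_series Delta (2 * expR 1 * N * `|l|).
Proof.
pose f n x : \bar R :=
  (2 * ((l * X x) ^+ (n.+1).*2 / ((n.+1).*2)`!%:R))%:E.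
have even_ge0 (y : R) n : (0 <= y ^+ (n.+1).*2)%R.
  by rewrite -mul2n exprM exprn_ge0 ?sqr_ge0.
have f0 n x : 0 <= f n x.
  by rewrite lee_fin mulr_ge0// divr_ge0.
have mf n : measurable_fun setT (f n).
  apply/measurable_EFinP; apply: measurable_funM => //.
  apply: measurable_funM => //; apply: measurable_funX.
  exact: measurable_funM.
have mh : measurable_fun setT (fun x => (expR (l * X x) - 1 - l * X x)%:E).
  apply/measurable_EFinP; apply: measurable_funB; last exact: measurable_funM.
  apply: measurable_funB => //; apply: measurableT_comp => //.
  exact: measurable_funM.
apply: (@le_trans _ _ (\int[P]_x \sum_(n <oo) f n x)).
  apply: ge0_le_integral => //.
  - by move=> x _; rewrite lee_fin; have := expR_ge1Dx (l * X x); lra.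
  - exact: ge0_emeasurable_sum.
  - by move=> x _; exact: expR_sub1x_le.
rewrite integral_nneseries//; apply: lee_nneseries => [n _ _|n _].
  exact: integral_ge0.
set k := (n.+1).*2.
have k0 : (0 < k)%N by rewrite /k doubleS.
have fact0 : (0 < k`!%:R :> R)%R by rewrite ltr0n fact_gt0.
have -> : \int[P]_x f n x =
    (2 * `|l| ^+ k / k`!%:R)%:E * \int[P]_x (`|X x| ^+ k)%:E.
  rewrite -ge0_integralZl_EFin//.
    apply: eq_integral => x _; rewrite /f -EFinM; congr (_%:E).
    have -> : ((l * X x) ^+ k = (`|l| * `|X x|) ^+ k)%R.
      by rewrite -normrM -normrX ger0_norm//; exact: even_ge0.
    by rewrite exprMn; ring.
  by apply/measurable_EFinP; apply: measurable_funX; exact: measurableT_comp.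
clearbody k.
apply: (le_trans (lee_wpmul2l _ (moment_le k k0))).
  by rewrite lee_fin divr_ge0 ?mulr_ge0 ?exprn_ge0.
rewrite -EFinM lee_fin mulrA ler_wpM2r ?expR_ge0//.
have -> : (2 * `|l| ^+ k / k`!%:R * (N * k%:R) ^+ k =
           (2 * (`|l| * N) ^+ k) * (k%:R ^+ k / k`!%:R))%R.
  by rewrite !exprMn; field; rewrite gt_eqF.
have -> : ((2 * expR 1 * N * `|l|) ^+ k =
           (2 ^+ k * (`|l| * N) ^+ k) * expR k%:R)%R.
  by rewrite -[in RHS](mulr1 k%:R) expRM_natl -!exprMn; congr (_ ^+ k)%R; ring.
(* The factors are compared separately: [2 <= 2 ^+ k] absorbs the coefficient 2, and
   [k ^ k / k! <= e ^ k] produces the factor e in the argument. *)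
apply: ler_pM.
- by rewrite mulr_ge0// exprn_ge0// mulr_ge0// ltW.
- by rewrite divr_ge0 ?exprn_ge0.
- rewrite ler_wpM2r ?exprn_ge0// ?mulr_ge0 ?(ltW N0)//.
  by rewrite ler_eXnr// ler1n.
- by rewrite ler_pdivrMr// mulrC exprn_le_fact_expR.
Qed.

Lemma mmt_gen_fun_le (l : R) : centered P X ->
  'M_P X l <= 1 + even_series Delta (2 * expR 1 * N * `|l|).
Proof.
move=> cX; have hG := expectation_sub1x_le l.
(* Finiteness of the series makes [expR (l * X) - 1 - l * X] integrable, so that the integral below
   may be split; centering then reduces the integral of [1 + l * X] to 1. *)
have [->|/eqP S_fin] := eqVneq (even_series Delta (2 * expR 1 * N * `|l|)) +oo.
  by rewrite addey ?leey.
have mX : measurable_fun setT (fun x => l * X x)%R by exact: measurable_funM.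
have mh : measurable_fun setT (fun x => expR (l * X x) - 1 - l * X x)%R.
  apply: measurable_funB => //; apply: measurable_funB => //.
  exact: measurableT_comp.
have h0 x : (0 <= expR (l * X x) - 1 - l * X x)%R.
  by have := expR_ge1Dx (l * X x); lra.
have ih : P.-integrable setT (fun x => (expR (l * X x) - 1 - l * X x)%:E).
  apply/integrableP; split; first exact/measurable_EFinP.
  under eq_integral do rewrite gee0_abs ?lee_fin//.
  by apply: le_lt_trans hG _; rewrite ltey; apply/eqP.
have ilX : P.-integrable setT (fun x => l%:E * (X x)%:E).
  exact/integrableZl/normG_integrable.
have i1 : P.-integrable setT (cst 1 : T -> \bar R).
  exact: finite_measure_integrable_cst.
have I1 : \int[P]_x (1 : \bar R) = 1.
  by rewrite (integral_cst _ measurableT) mul1e; exact: probability_setT.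
have EX : \int[P]_x (X x)%:E = 0 by rewrite -expectation_def.
rewrite /mmt_gen_fun unlock.
under eq_integral => x _.
  rewrite (_ : _%:E = (expR (l * X x) - 1 - l * X x)%:E + (1 + l%:E * (X x)%:E)).
    over.
  by rewrite /= -EFinM -!EFinD (mulrC (X x)); congr (_%:E); ring.
rewrite integralD//; last exact: integrableD.
rewrite integralD// integralZl//; last exact: normG_integrable.
rewrite EX I1 mule0 adde0.
by rewrite addeC leeD2l.
Qed.

End moments.

(** * Comparison of the two norms *)

Lemma normG_ge0 d (T : measurableType d) (R : realType) (P : probability T R)
  (Delta : R -> R) (X : T -> R) : 0 <= normG P (psi_Delta Delta) X.
Proof.
apply: (@le_trans _ _ ('N[P]_1[EFin \o X] * ((psi_Delta Delta 1)^-1)%:E)).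
  by rewrite mule_ge0 ?Lnorm_ge0// lee_fin invr_ge0 mulr_ge0 ?expR_ge0.
by apply: ereal_sup_ubound; exists 1%R => /=.
Qed.


Theorem theorem4p2 (R : realType) (Delta : R -> R) (phi : R -> R)
    (hDelta : condition_Delta Delta)
    (hphi : forall l : R, phi_Delta Delta l = (phi l)%:E)
    (hPhi : class_Phi phi) :
  exists C : R,
    forall (d : measure_display) (T : measurableType d) (P : probability T R)
      (xi : {RV P >-> R}),
      centered P xi -> in_G P (psi_Delta Delta) xi ->
      normB P phi xi <= C%:E * normG P (psi_Delta Delta) xi.
Proof.
have [C4 C41 hC] := hDelta.
have C40 : (0 < C4)%R by rewrite (lt_le_trans _ C41).
have S_le (r : R) : (0 < r)%R ->
    even_series Delta r <= (expR (phi (C4 * r)))%:E.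
  move=> r0; apply: (le_trans (even_series_le_Delta1 Delta r r0)).
  rewrite [leRHS](_ : _ = expeR (phi (C4 * r))%:E)// lee_expeR.
  have := hC r (lt0r_neq0 r0); rewrite gtr0_norm// => /le_trans; apply.
  by rewrite -hphi /phi_Delta mulf_eq0 !gt_eqF.
(* The coefficient [expR (phi C4)] bounds the even series at 1, by [S_le]. *)
have [B [B0 small large]] :=
  Phi_absorb hPhi (expR (phi C4)) C4 (expR_ge0 _) C41.
have S1_le (r : R) : (0 <= r)%R ->
    1 + even_series Delta r <= (expR (phi (B * r)))%:E.
  move=> r0; have [r1|r1] := leP r 1%R.
    have r01 : (0 <= r <= 1)%R by rewrite r0.
    apply: (@le_trans _ _ (1 + expR (phi C4) * r ^+ 2)%:E); last first.
      by rewrite lee_fin small.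
    rewrite EFinD leeD2l//; apply: (le_trans (even_series_le1 Delta r r01)).
    rewrite [leRHS]EFinM [leRHS]muleC lee_wpmul2l ?lee_fin ?sqr_ge0//.
    by have := S_le 1%R ltr01; rewrite mulr1.
  apply: (@le_trans _ _ (1 + expR (phi (C4 * r)))%:E).
    by rewrite EFinD leeD2l// S_le// (lt_trans _ r1).
  by rewrite lee_fin large// ltW.
(* [B] comes from absorbing the summand 1 and [2 * expR 1] from the moment bound; both are fixed
   before the probability space. *)
pose C : R := (B * (2 * expR 1))%R.
have C0 : (0 < C)%R by rewrite !mulr_gt0 ?expR_gt0.
exists C => d T P xi cxi xiG.
have normB_le (N : R) : (0 < N)%R -> normG P (psi_Delta Delta) xi <= N%:E ->
    normB P phi xi <= (C * N)%:E.
  move=> N0 xiN; apply: ereal_inf_lbound; exists (C * N)%R => //; split.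
    by rewrite mulr_gt0.
  have phi_norm (x : R) : phi `|x|%R = phi x.
    by have [_|_] := ger0P x; rewrite ?(Phi_even hPhi).
  (* Since [phi] is even, this bound at [l] and at [- l] has the same right side, which settles the
     maximum. *)
  have mgf (l : R) : 'M_P xi l <= (expR (phi (l * (C * N))))%:E.
    have -> : phi (l * (C * N))%R = phi (B * (2 * expR 1 * N * `|l|))%R.
      rewrite -phi_norm normrM (gtr0_norm (mulr_gt0 C0 N0)); congr phi.
      by rewrite /C; ring.
    apply: (le_trans (mmt_gen_fun_le _ _ _ _ _ _ _ N0 xiN l cxi)).
    by apply: S1_le; rewrite !mulr_ge0 ?expR_ge0// ltW.
  move=> l; rewrite ge_max mgf/=.
  by have := mgf (- l)%R; rewrite mulNr (Phi_even hPhi).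
have G_fin : normG P (psi_Delta Delta) xi \is a fin_num.
  by rewrite ge0_fin_numE ?normG_ge0.
have n0 := fine_ge0 (normG_ge0 _ _ _ P Delta xi).
(* Room is left for [normG] to be 0, as [normB] takes an infimum over positive
   [tau]. *)
apply/lee_addgt0Pr => e e0.
have eC0 : (0 < e / C)%R by rewrite divr_gt0.
set n := fine (normG P (psi_Delta Delta) xi) in n0.
have nG : n%:E = normG P (psi_Delta Delta) xi by rewrite fineK.
apply: (le_trans (normB_le (n + e / C)%R _ _)).
- by rewrite ltr_wpDl.
- by rewrite -nG lee_fin lerDl ltW.
- by rewrite -nG -EFinM -EFinD lee_fin mulrDr mulrCA divff ?gt_eqF// mulr1.
Qed.
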